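(* Let $q\in\mathbb{C}^\times$, let $n\ge1$ and $k\ge 0$ be integers, let $\lambda$ be a composition and let $x\in N\Lambda^q$. Then $$(h_nh_\lambda,e_kx)=q^{(k-1)(n-1)}(h_\lambda,e_{k-1}x)_{h_{n-1}}+q^{kn}(h_\lambda,e_kx)_{h_n}.$$
   Context: $N\Lambda^q$ is the free associative $\mathbb{Z}$-graded $\mathbb{C}$-algebra on generators $h_m$ ($m\ge1$, $\deg h_m=m$), with $h_0=1$, $h_m=0$ for $m<0$; $h_\alpha=h_{\alpha_1}\cdots h_{\alpha_z}$ for a composition $\alpha$. $N\Lambda^q\otimes N\Lambda^q$ has multiplication $(w\otimes x)(y\otimes z)=q^{\deg(x)\deg(y)}(wy\otimes xz)$, and $\Delta:N\Lambda^q\to N\Lambda^q\otimes N\Lambda^q$ is the algebra homomorphism with $\Delta(h_m)=\sum_{j=0}^m h_j\otimes h_{m-j}$. The bilinear form is $(h_\lambda,h_\mu)=\sum_{C\in S_\lambda\backslash S_N/S_\mu}q^{\ell(w_C)}$ for compositions $\lambda,\mu$ of $N$ ($S_\lambda,S_\mu$ Young subgroups, $w_C$ the minimal length representative of $C$), and $0$ if $|\lambda|\ne|\mu|$. It satisfies $(y_1y_2,x)=(y_1\otimes y_2,\Delta(x))$ with $(w\otimes x,y\otimes z)=(w,y)(x,z)$. The elements $e_k$ are defined by $e_k=0$ for $k<0$, $e_0=1$ and $\sum_{i=0}^k(-1)^iq^{\binom i2}e_ih_{k-i}=0$ for $k\ge1$. Insertion: $(h_\lambda,e_kx)$ is computed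 by expanding it as a linear combination of terms $(h_\alpha,x)$, by recording how the strands of $h_\lambda$ are split between $e_k$ and $x$; $(h_\lambda,e_kx)_{h_\mu}$ denotes the result of the same computation with $h_\mu$ put at the beginning of $h_\alpha$ in every term $(h_\alpha,x)$. Explicitly, writing $\Delta(h_\lambda)=\sum a\otimes b$, $$(h_\lambda,e_kx)=\sum(a,e_k)(b,x),\qquad (h_\lambda,e_kx)_{h_\mu}=\sum(a,e_k)(h_\mu b,x).$$ For example $(h_2h_3,e_1x)_{h_1}=(h_1h_1h_3,x)+q^2(h_1h_2h_2,x)$. *)

(* Defs.v *)
From HB Require Import structures.
From mathcomp Require Import all_boot all_order all_fingroup all_algebra.
From mathcomp Require Import finmap.
From mathcomp Require Import monalg.

Set Implicit Arguments.
Unset Strict Implicit.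
Unset Printing Implicit Defensive.

Import GRing.Theory.
Local Open Scope ring_scope.

Definition is_composition (lam : seq nat) : bool := all (fun m => 0 < m)%N lam.

Section DoubleCosets.
Variable N : nat.
Implicit Types (s : 'S_N) (lam mu : seq nat).

(* [reshape_index lam i] is the block of the ordered set partition of
   {0, ..., |lam| - 1} into consecutive intervals of lengths lam_1, lam_2, ...
   that contains i; S_lam consists of the permutations preserving each block. *)
Definition young lam : {set 'S_N} :=
  [set s : 'S_N | [forall i, reshape_index lam (s i) == reshape_index lam i]].

Lemma young_group_set lam : group_set (young lam).
Proof.
apply/group_setP; split.
  by rewrite inE; apply/forallP=> i; rewrite perm1.
move=> s t; rewrite !inE => /forallP hs /forallP ht.
by apply/forallP=> i; rewrite permM (eqP (ht _)) hs.
Qed.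
Canonical young_group lam := Group (young_group_set lam).

(* The Coxeter length of a permutation: its number of inversions. *)
Definition perm_length s : nat :=
  #|[set p : 'I_N * 'I_N | (p.1 < p.2)%N && (s p.2 < s p.1)%N]|.

(* Products in 'S_N compose from left to right. With the opposite convention
   every double coset is replaced by its image under inversion, which preserves
   lengths. *)
Definition double_cosets lam mu : {set {set 'S_N}} :=
  [set (young lam * [set w] * young mu)%g | w : 'S_N].

Definition min_rep (C : {set 'S_N}) : 'S_N :=
  [arg min_(w < repr C in C) perm_length w]%N.

Lemma min_repP lam mu C : C \in double_cosets lam mu ->
  min_rep C \in C /\ forall w, w \in C -> (perm_length (min_rep C) <= perm_length w)%N.
Proof.
case/imsetP=> w _ defC.
have Cw : w \in C.
  have: (1 * w * 1)%g \in C
    by rewrite defC !mem_mulg ?set11 ?(group1 (young_group _)).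
  by rewrite mul1g mulg1.
by rewrite /min_rep; case: arg_minnP => [|m Cm mP]; [exact: mem_repr Cw | split].
Qed.

End DoubleCosets.

(* Linear extension to {malg F[K]}, the free module on K, of a map given on the
   basis K. *)
HB.lock Definition lin_ext (F : fieldType) (K : choiceType) (V : lmodType F)
    (f : K -> V) (x : {malg F[K]}) : V :=
  \sum_(k <- msupp x) x@_k *: f k.
Canonical lin_ext_unlockable := Unlockable lin_ext.unlock.

Section LinearExtension.
Variables (F : fieldType) (K : choiceType) (V : lmodType F).
Implicit Types (f : K -> V) (x y : {malg F[K]}).

Lemma lin_extE f x : lin_ext f x = \sum_(k <- msupp x) x@_k *: f k.
Proof. by rewrite unlock. Qed.

Lemma lin_extEw (d : {fset K}) f x : (msupp x `<=` d)%fset ->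
  lin_ext f x = \sum_(k <- d) x@_k *: f k.
Proof.
move=> le; rewrite lin_extE (big_fset_incl _ le) //= => k _ /mcoeff_outdom ->.
by rewrite scale0r.
Qed.

Lemma lin_extU f k : lin_ext f << k >> = f k.
Proof. by rewrite (lin_extEw _ msuppU_le) big_seq_fset1 mcoeffUU scale1r. Qed.

Lemma lin_ext_is_linear f : linear (lin_ext f).
Proof.
move=> c x y.
pose d := (msupp (c *: x + y) `|` (msupp x `|` msupp y))%fset.
rewrite !(@lin_extEw d) /d ?fsubsetUl //.
- rewrite scaler_sumr -big_split; apply: eq_bigr => k _ /=.
  by rewrite mcoeffD mcoeffZ scalerDl scalerA.
- by rewrite (fsubset_trans _ (fsubsetUr _ _)) ?fsubsetUr.
- by rewrite (fsubset_trans _ (fsubsetUr _ _)) ?fsubsetUl.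
Qed.
HB.instance Definition _ f :=
  GRing.isLinear.Build F {malg F[K]} V *:%R (lin_ext f) (lin_ext_is_linear f).

Lemma eq_lin_ext f g : f =1 g -> lin_ext f =1 lin_ext g.
Proof. by move=> fg x; rewrite !lin_extE; apply: eq_bigr => k _; rewrite fg. Qed.

Lemma scale_malgU (c d : F) (k : K) : c *: << d *g k >> = << c * d *g k >>.
Proof. by apply/malgP => l; rewrite mcoeffZ !mcoeffU mulrnAr. Qed.

Lemma lin_ext_id (x : {malg F[K]}) :
  x = \sum_(k <- msupp x) x@_k *: << k >>.
Proof.
by rewrite {1}[x]monalgE; apply: eq_bigr => k _; rewrite scale_malgU mulr1.
Qed.

Lemma eq_on_basis (f g : {malg F[K]} -> V) : linear f -> linear g ->
  (forall k, f << k >> = g << k >>) -> f =1 g.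
Proof.
move=> lf lg fg x; rewrite [x]lin_ext_id.
have l0 (u : {malg F[K]} -> V) : linear u -> u 0 = 0.
  by move=> lu; have := lu (-1) 0 0; rewrite scaler0 addr0 scaleN1r addNr.
by elim/big_rec: _ => [|k y _ IHy]; rewrite ?l0 // lf lg fg IHy.
Qed.

Lemma lin_ext_fun_linear c f g x :
  lin_ext (fun k => c *: f k + g k) x = c *: lin_ext f x + lin_ext g x.
Proof.
rewrite !lin_extE scaler_sumr -big_split; apply: eq_bigr => k _ /=.
by rewrite scalerDr !scalerA mulrC.
Qed.

End LinearExtension.

Lemma linear_comp (F : fieldType) (U V W : lmodType F) (f : V -> W) (g : U -> V) :
  linear f -> linear g -> linear (f \o g).
Proof. by move=> lf lg c x y; rewrite /= lg lf. Qed.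

(* A letter i : nat stands for the generator h_(i+1), so that a word is a
   monomial h_alpha, with alpha the composition [parts w]. *)
Notation word := {fmonom nat}.

Definition parts (w : word) : seq nat := [seq i.+1 | i <- (w : seq nat)].
Definition wdeg (w : word) : nat := sumn (parts w).

Notation NLam F := {malg F[word]}.
Notation NLam2 F := {malg F[(word * word)%type]}.

Section QuantumNSym.
Variables (F : fieldType) (q : F).
Implicit Types (x y : NLam F) (s t : NLam2 F) (lam mu : seq nat).

Definition h (m : int) : NLam F :=
  match m with
  | Posz 0 => 1
  | Posz m'.+1 => << fmu m' >>
  | Negz _ => 0
  end.

Definition hcomp lam : NLam F := \prod_(m <- lam) h m%:Z.

(* A basis pair (u, v) of NLam2 F is the tensor u (x) v. *)
Definition tensor x y : NLam2 F :=
  lin_ext (fun u => lin_ext (fun v => << (u, v) >>) y) x.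

Definition tmul s t : NLam2 F :=
  lin_ext (fun a =>
    lin_ext (fun b =>
      q ^+ (wdeg a.2 * wdeg b.1) *: << (mmul a.1 b.1, mmul a.2 b.2) >>) t) s.

Definition Delta_h (m : nat) : NLam2 F :=
  \sum_(j < m.+1) tensor (h j%:Z) (h (m%:Z - j%:Z)).

(* Words are mapped to products for tmul; DeltaM and Delta_hE below show that
   Delta is the algebra homomorphism with Delta (h_m) = Delta_h m. *)
Definition Delta_word (w : word) : NLam2 F :=
  \big[tmul/tensor 1 1]_(m <- parts w) Delta_h m.

Definition Delta x : NLam2 F := lin_ext Delta_word x.

Definition form_comp lam mu : F :=
  if sumn lam == sumn mu then
    \sum_(C in @double_cosets (sumn lam) lam mu) q ^+ perm_length (min_rep C)
  else 0.

Definition hform x y : F :=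
  @lin_ext F word F^o (fun u =>
    @lin_ext F word F^o (fun v => form_comp (parts u) (parts v)) y) x.

(* The relation sum_(i <= n) (-1)^i q^C(i,2) e_i h_(n-i) = 0 solved for e_n;
   [e_list n] is [:: e_0; ...; e_n]. *)
Fixpoint e_list (n : nat) : seq (NLam F) :=
  if n is n'.+1 then
    let es := e_list n' in
    rcons es (- ((-1) ^+ n * q ^+ 'C(n, 2))^-1 *:
      \sum_(i < n) ((-1) ^+ i * q ^+ 'C(i, 2)) *: (es`_i * h (n%:Z - i%:Z)))
  else [:: 1].

Definition e (k : int) : NLam F :=
  match k with
  | Posz n => (e_list n)`_n
  | Negz _ => 0
  end.

(* (h_lam, e_k x)_(h_mu), with y = h_mu the element put in front of the second
   tensor factor. *)
Definition insertion lam (k : int) x y : F :=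
  @lin_ext F (word * word)%type F^o
    (fun ab => hform << ab.1 >> (e k) * hform (y * << ab.2 >>) x)
    (Delta (hcomp lam)).

Lemma size_e_list n : size (e_list n) = n.+1.
Proof. by elim: n => //= n IHn; rewrite size_rcons IHn. Qed.

Lemma e_list_nth n i : (i <= n)%N -> (e_list n)`_i = e i%:Z.
Proof.
elim: n => [|n IHn]; first by case: i.
rewrite leq_eqVlt => /orP[/eqP-> //|lt_in].
by rewrite /= nth_rcons size_e_list lt_in IHn.
Qed.

Lemma e_neg (k : int) : (k < 0)%R -> e k = 0.
Proof. by case: k. Qed.

Lemma e0 : e 0 = 1. Proof. by []. Qed.

Lemma e_rel (n : nat) : q != 0 -> (0 < n)%N ->
  \sum_(i < n.+1) ((-1) ^+ i * q ^+ 'C(i, 2)) *: (e i%:Z * h (n%:Z - i%:Z)) = 0.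
Proof.
move=> q0; case: n => // n _.
rewrite big_ord_recr /= subrr mulr1 nth_rcons size_e_list ltnn eqxx.
rewrite scalerA mulrN divff ?mulf_neq0 ?expf_neq0 ?oppr_eq0 ?oner_eq0 //.
rewrite scaleN1r -sumrB big1 // => i _.
have le_in : (i <= n)%N by rewrite -ltnS.
by rewrite (e_list_nth le_in) subrr.
Qed.

Lemma hcomp_word (w : word) : hcomp (parts w) = << w >>.
Proof.
rewrite /hcomp /parts; case: w => s; elim: s => [|i s IHs] /=.
  by rewrite big_nil; congr << _ *g _ >>; apply/eqP; rewrite fmP fm1.
rewrite big_cons IHs /= -[RHS]/(<< _ >>) [LHS]fgmulUU mulr1; congr << _ *g _ >>.
by apply/eqP; rewrite fmP fmM fmuE.
Qed.

Lemma hform_hcomp lam mu : is_composition lam -> is_composition mu ->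
  hform (hcomp lam) (hcomp mu) = form_comp lam mu.
Proof.
have partsK nu : is_composition nu -> exists w, nu = parts w.
  move=> /allP nu_gt0; exists (FMonom [seq i.-1 | i <- nu]).
  rewrite /parts /= -map_comp map_id_in // => i /nu_gt0; exact: prednK.
move=> /partsK[u ->] /partsK[v ->]; rewrite !hcomp_word.
by rewrite /hform !lin_extU.
Qed.

Lemma tensorU (u v : word) : tensor << u >> << v >> = << (u, v) >>.
Proof. by rewrite /tensor !lin_extU. Qed.

Lemma tmulU (a b : word * word) : tmul << a >> << b >> =
  q ^+ (wdeg a.2 * wdeg b.1) *: << (mmul a.1 b.1, mmul a.2 b.2) >>.
Proof. by rewrite /tmul !lin_extU. Qed.

Lemma tmul_linearl t : linear (tmul^~ t).
Proof. by move=> c s1 s2; rewrite /tmul lin_ext_is_linear. Qed.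

Lemma tmul_linearr s : linear (tmul s).
Proof.
move=> c t1 t2; rewrite /tmul.
apply: etrans (lin_ext_fun_linear _ _ _ _).
apply: eq_lin_ext => a.
exact: lin_ext_is_linear.
Qed.

Lemma tmulZl c s t : tmul (c *: s) t = c *: tmul s t.
Proof. exact: (linearZ_LR (lin_ext _)). Qed.

Lemma tmulZr c s t : tmul s (c *: t) = c *: tmul s t.
Proof.
apply: etrans (congr1 (tmul s) (esym (addr0 _))) _.
apply: etrans (tmul_linearr s c t 0) _.
have tmulr0 : tmul s 0 = 0.
  by rewrite /tmul lin_extE big1 // => a _; rewrite lin_extE msupp0 big_nil scaler0.
by apply: etrans (congr1 (+%R _) tmulr0) _; exact: addr0.
Qed.

Lemma wdegM (u v : word) : wdeg (mmul u v) = (wdeg u + wdeg v)%N.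
Proof. by rewrite /wdeg /parts fmM map_cat sumn_cat. Qed.

Lemma tmulA : associative tmul.
Proof.
have A3 a b d : tmul << a >> (tmul << b >> << d >>) = tmul (tmul << a >> << b >>) << d >>.
  apply: etrans (congr1 (tmul << a >>) (tmulU b d)) _.
  apply: etrans (tmulZr _ _ _) (etrans (congr1 _ (tmulU _ _)) _).
  apply: etrans _ (esym (congr1 (tmul^~ << d >>) (tmulU a b))).
  apply: etrans _ (esym (etrans (tmulZl _ _ _) (congr1 _ (tmulU _ _)))).
  rewrite !scalerA /= !mulmA -!exprD !wdegM.
  apply: (congr1 (fun n => q ^+ n *: _)).
  by rewrite mulnDl mulnDr addnC addnA.
have A2 a b r : tmul << a >> (tmul << b >> r) = tmul (tmul << a >> << b >>) r.
  by apply: (@eq_on_basis _ _ _ (tmul << a >> \o tmul << b >>)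
    (tmul (tmul << a >> << b >>)) _ _ (A3 a b) r);
    [exact: linear_comp (@tmul_linearr _) (@tmul_linearr _) | exact: tmul_linearr].
have A1 a t r : tmul << a >> (tmul t r) = tmul (tmul << a >> t) r.
  by apply: (@eq_on_basis _ _ _ (tmul << a >> \o tmul^~ r)
    (tmul^~ r \o tmul << a >>) _ _ (fun b => A2 a b r) t);
    [exact: linear_comp (@tmul_linearr _) (@tmul_linearl _)
    |exact: linear_comp (@tmul_linearl _) (@tmul_linearr _)].
move=> s t r.
by apply: (@eq_on_basis _ _ _ (tmul^~ (tmul t r)) (tmul^~ r \o tmul^~ t)
  _ _ (fun a => A1 a t r) s);
  [exact: tmul_linearl | exact: linear_comp (@tmul_linearl _) (@tmul_linearl _)].
Qed.

Lemma NLam1E : 1 = << (mone : word) >> :> NLam F.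
Proof. by []. Qed.

Lemma tmul1 t : tmul (tensor 1 1) t = t.
Proof.
rewrite NLam1E tensorU; apply: (eq_on_basis (g := id)) => [||[u v]] //.
  exact: tmul_linearr.
by rewrite tmulU /= !mul1m /wdeg /parts fm1 mul0n scale1r.
Qed.

Lemma tmulr1 t : tmul t (tensor 1 1) = t.
Proof.
rewrite NLam1E tensorU.
apply: (eq_on_basis (f := tmul^~ _) (g := id)) => [||[u v]] //.
  exact: tmul_linearl.
by rewrite tmulU /= !mulm1 /wdeg /parts fm1 muln0 scale1r.
Qed.

Lemma Delta_hE (m : nat) : Delta (h m%:Z) = Delta_h m.
Proof.
case: m => [|m].
  rewrite /Delta_h big_ord1 /h NLam1E /Delta lin_extU /Delta_word /parts fm1.
  by rewrite big_nil.
by rewrite /Delta lin_extU /Delta_word /parts fmuE big_seq1_id tmulr1.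
Qed.

Lemma Delta_wordM (u v : word) :
  Delta_word (mmul u v) = tmul (Delta_word u) (Delta_word v).
Proof.
rewrite /Delta_word /parts fmM map_cat; elim: (u : seq nat) => [|i s IHs] /=.
  by rewrite big_nil tmul1.
by rewrite !big_cons IHs tmulA.
Qed.

Lemma DeltaM x y : Delta (x * y) = tmul (Delta x) (Delta y).
Proof.
have Delta_lin : linear Delta by exact: lin_ext_is_linear.
have mull_lin z : linear (fun w : NLam F => w * z).
  by move=> c u v; rewrite mulrDl scalerAl.
have mulr_lin z : linear (fun w : NLam F => z * w).
  move=> c u v; rewrite mulrDr; congr (_ + _).
  rewrite [LHS](fgmullw (fsubset_refl _) (msuppZ_le _ _)) scaler_sumr.
  apply: eq_bigr => k _; rewrite scaler_sumr; apply: eq_bigr => l _.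
  apply: etrans (esym (scale_malgU _ _ _)).
  exact: congr1 (etrans (congr1 _ (mcoeffZ _ _ _)) (mulrCA _ _ _)).
have M2 u v : Delta (<< u >> * << v >>) = tmul (Delta << u >>) (Delta << v >>).
  apply: etrans (congr1 Delta (fgmulUU _ _ _ _)) _; rewrite mulr1.
  apply: etrans (lin_extU _ _) _; apply: etrans (Delta_wordM _ _) _.
  by apply: congr2; apply: esym; exact: lin_extU.
have M1 u z : Delta (<< u >> * z) = tmul (Delta << u >>) (Delta z).
  by apply: (@eq_on_basis _ _ _ (Delta \o *%R << u >>) (tmul (Delta << u >>) \o Delta)
    _ _ (M2 u) z);
    [exact: linear_comp Delta_lin (mulr_lin _)
    |exact: linear_comp (@tmul_linearr _) Delta_lin].
by apply: (@eq_on_basis _ _ _ (Delta \o *%R^~ y) (tmul^~ (Delta y) \o Delta)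
  _ _ (fun u => M1 u y) x);
  [exact: linear_comp Delta_lin (mull_lin _)
  |exact: linear_comp (@tmul_linearl _) Delta_lin].
Qed.

End QuantumNSym.

Arguments h {F} m.
Arguments hcomp {F} lam.

(* Main.v *)
Require Import Defs.
From mathcomp Require Import all_boot all_order all_fingroup all_algebra.
From mathcomp Require Import reals complex finmap monalg.
From mathcomp Require Import zify ring.

Set Implicit Arguments.
Unset Strict Implicit.
Unset Printing Implicit Defensive.

Import Order.TTheory GRing.Theory Num.Theory.
Local Open Scope ring_scope.
Local Open Scope complex_scope.

(** The product e_k x is moved to the other side of the form by the adjointness
    (y, y1 y2) = (Delta y, y1 (x) y2).  For y = h_n h_lam, multiplicativity of
    Delta gives Delta y = sum_j (h_j (x) h_(n-j)) Delta(h_lam), and a term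
    a (x) b of Delta(h_lam) contributes
      q^((n-j) deg a) (h_j a, e_k) (h_(n-j) b, x).
    The element e_k is dual to h_1^k: (h_alpha, e_k) is 1 if alpha = (1, ..., 1)
    with k parts and 0 for every other composition.  Hence only j = 0, with
    deg a = k, and j = 1, with deg a = k - 1, survive, and these are the two
    terms of the formula ([evaluate_is_ones]).

    Adjointness is combinatorial.  The double cosets of S_lam and S_mu are
    indexed by the nonnegative integer matrices with row sums lam and column
    sums mu, and the minimal length in a double coset is the number of
    inversions of its matrix: the sum of a_ij a_kl over i < k, j > l.  So
    (h_lam, h_mu) = sum_A q^inv(A), which [matrix_sum] computes row by row.
    Cutting the matrices between two columns, the inversions across the cut give
    the power of q in the twisted product of NLam (x) NLam
    ([row_sum_cat], [matrix_sum_cat]).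

    The matrix formula ([form_compE]) is obtained from words.  A permutation w
    has a word, the sequence of the mu-blocks of w(0), w(1), ....
    Multiplying w on the right by S_mu does not change the word, and
    multiplying it on the left by S_lam permutes letters inside the lam-blocks
    of positions, so a double coset contains exactly one word that increases
    weakly on every lam-block, and the inversions of that word are the minimal
    length.  Reading such words letter by letter gives [matrix_sum].

    The duality of e_k follows from its defining recursion by induction on k:
    under the form with h_alpha, the terms of the alternating sum cancel in
    pairs when the first part of alpha is split off ([ones_alternating]). *)

(** * Sums over matrices with prescribed margins *)

Section MatrixSum.
Variables (F : fieldType) (q : F).
Implicit Types (lam mu nu : seq nat) (l : nat) (K : seq nat -> F).

(** The sum over the possible first rows r, of total l, of a matrix with column
    sums mu; K receives the column sums mu - r left for the other rows.  The
    weight counts the inversions between the first row and the rows below: when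
    j is put in a column of sum m, the l - j remaining units of the row lie to
    the right of the m - j units of this column that are below. *)
Fixpoint row_sum mu l K : F :=
  if mu is m :: mu' then
    \sum_(j < m.+1 | (j <= l)%N)
      q ^+ ((l - j) * (m - j)) *
        row_sum mu' (l - j) (fun s => K ((m - j)%N :: s))
  else if l == 0%N then K [::] else 0.

Fixpoint matrix_sum lam mu : F :=
  if lam is l :: lam' then row_sum mu l (matrix_sum lam')
  else (sumn mu == 0%N)%:R.

(** Only column sums of the right total reach K; this is what makes degrees
    available when exponents of q are compared. *)
Lemma eq_row_sum mu l K1 K2 :
  (forall s, (sumn s + l = sumn mu)%N -> K1 s = K2 s) ->
  row_sum mu l K1 = row_sum mu l K2.
Proof.
elim: mu l K1 K2 => [|m mu IH] l K1 K2 eqK /=.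
  by case: eqP => // l0; apply: eqK; rewrite l0.
apply: eq_bigr => j le_jl; congr (_ * _); apply: IH => s eq_s.
by apply: eqK => /=; have := ltn_ord j; lia.
Qed.

Lemma row_sum_linear mu l c K1 K2 :
  row_sum mu l (fun s => c * K1 s + K2 s) =
    c * row_sum mu l K1 + row_sum mu l K2.
Proof.
elim: mu l K1 K2 => [|m mu IH] l K1 K2 /=.
  by case: eqP; rewrite ?mulr0 ?addr0.
rewrite mulr_sumr -big_split; apply: eq_bigr => j _ /=.
by rewrite IH; ring.
Qed.

Lemma row_sum_0 mu l : row_sum mu l (fun=> 0) = 0.
Proof.
elim: mu l => [|m mu IH] l /=; first by case: eqP.
by rewrite big1 // => j _; rewrite IH mulr0.
Qed.

Lemma row_sumZ mu l c K : row_sum mu l (fun s => c * K s) = c * row_sum mu l K.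
Proof.
rewrite -[RHS]addr0 -(row_sum_0 mu l) -row_sum_linear.
by apply: eq_row_sum => s _; rewrite addr0.
Qed.

Lemma row_sum_oversize mu l K : (sumn mu < l)%N -> row_sum mu l K = 0.
Proof.
by move=> lt_l; rewrite -(row_sum_0 mu l); apply: eq_row_sum => s; lia.
Qed.

Lemma row_sum_nil mu K : row_sum mu 0 K = K mu.
Proof.
elim: mu K => [|m mu IH] K //=.
by rewrite big_mkcond big_ord_recl /= !subn0 mul0n mul1r IH big1 ?addr0.
Qed.

(** Either the first row has a zero in the first column, or one unit is taken
    from that column and the others are placed in the same way: the recursion
    that reads a row one letter at a time. *)
Lemma row_sumS m mu l K :
  row_sum (m :: mu) l.+1 K =
    q ^+ (l.+1 * m) * row_sum mu l.+1 (fun s => K (m :: s)) +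
    (if m is m'.+1 then row_sum (m' :: mu) l K else 0).
Proof.
rewrite /= big_mkcond big_ord_recl /= !subn0 -big_mkcond; congr (_ + _).
case: m => [|m]; first by rewrite big_ord0.
by apply: eq_big => j /=; rewrite /bump /= add1n ?ltnS // !subSS.
Qed.

Lemma row_sum1 m l K :
  row_sum [:: m] l K = if (l <= m)%N then K [:: (m - l)%N] else 0.
Proof.
rewrite /=; case: leqP => [le_lm|lt_ml].
  rewrite (bigD1 (Ordinal (le_lm : (l < m.+1)%N))) //= subnn mul0n mul1r.
  rewrite big1 ?addr0 // => j /andP[le_jl ne_jl].
  case: eqP => [eq0|]; rewrite ?mulr0 //; case/eqP: ne_jl.
  by apply: val_inj => /=; lia.
rewrite big1 // => j le_jl; case: eqP => [|]; rewrite ?mulr0 //.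
by have := ltn_ord j; lia.
Qed.

(** A row splits into its part j in the left block of columns and its part
    l - j in the right block.  The l - j units on the right form inversions with
    all the sumn mu - j units that lie below on the left, whatever the shapes of
    the two parts. *)
Lemma row_sum_cat mu nu l K :
  row_sum (mu ++ nu) l K =
    \sum_(j < l.+1) q ^+ ((l - j) * (sumn mu - j)) *
      row_sum mu j (fun s => row_sum nu (l - j) (fun t => K (s ++ t))).
Proof.
elim: mu l K => [|m mu IH] l K /=.
  rewrite big_ord_recl /= subn0 muln0 mul1r big1 ?addr0 // => j _.
  by rewrite mulr0.
under [RHS]eq_bigr do rewrite mulr_sumr.
rewrite (exchange_big_dep xpredT) //= big_mkcond; apply: eq_bigr => j _.
case: leqP => [le_jl|lt_lj]; last first.
  by rewrite big1 // => t; have := ltn_ord t; lia.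
rewrite IH mulr_sumr.
pose f t : F := q ^+ ((l - t) * (m + sumn mu - t)) *
  (q ^+ ((t - j) * (m - j)) *
   row_sum mu (t - j)
     (fun s => row_sum nu (l - t) (fun u => K ((m - j)%N :: s ++ u)))).
rewrite -(big_mkord (fun t => (j <= t)%N) f).
rewrite -(big_nat_widenl j 0 _ xpredT f) //.
have -> : \sum_(j <= t < l.+1) f t = \sum_(i < (l - j).+1) f (i + j)%N.
  by rewrite -{1}[nat_of_ord j]add0n big_addn subSn // big_mkord.
apply: eq_bigr => i _.
rewrite /f addnK -subnDA [(j + i)%N]addnC.
case: (leqP i (sumn mu)) => [le_iM|lt_Mi]; last first.
  by rewrite row_sum_oversize ?mulr0.
rewrite !mulrA -!exprD; congr (_ ^+ _ * _).
have {IH f} le_jm := ltn_ord j; have := ltn_ord i.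
move: (nat_of_ord i) le_iM => {}i le_iM le_i.
(* Truncated subtractions are removed before the exponents are compared. *)
have [a ea] : exists a, l = (a + i + j)%N by exists (l - i - j)%N; lia.
have [b eb] : exists b, m = (b + j)%N by exists (m - j)%N; lia.
have [d ed] : exists d, sumn mu = (d + i)%N by exists (sumn mu - i)%N; lia.
have -> : (l - (i + j) = a)%N by lia.
have -> : (m + sumn mu - (i + j) = b + d)%N by lia.
have -> : (l - j = a + i)%N by lia.
have -> : (m - j = b)%N by lia.
have -> : (sumn mu - i = d)%N by lia.
by rewrite mulnDl mulnDr; lia.
Qed.

Lemma matrix_sum_cons l lam mu :
  matrix_sum (l :: lam) mu = row_sum mu l (matrix_sum lam).
Proof. by []. Qed.

Lemma matrix_sum_neq lam mu : sumn lam != sumn mu -> matrix_sum lam mu = 0.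
Proof.
elim: lam mu => [|l lam IH] mu /=; first by rewrite eq_sym => /negPf->.
move=> ne; rewrite -(row_sum_0 mu l); apply: eq_row_sum => s eq_s.
by apply: IH; lia.
Qed.

Lemma matrix_sum1 lam m : matrix_sum lam [:: m] = (sumn lam == m)%:R.
Proof.
elim: lam m => [|l lam IH] m; first by rewrite /= addn0 eq_sym.
rewrite matrix_sum_cons row_sum1; case: leqP => [le_lm|lt_ml].
  by rewrite IH /=; congr (_%:R); lia.
by rewrite /= (_ : (l + sumn lam == m)%N = false) //; lia.
Qed.

End MatrixSum.

(** * Words with prescribed content *)

Section Words.
Implicit Types (lam mu c s : seq nat) (a l n p : nat).

Fixpoint words p n : seq (seq nat) :=
  if n is n'.+1 then [seq a :: c | a <- iota 0 p, c <- words p n']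
  else [:: [::]].

Fixpoint inversions c : nat :=
  if c is a :: c' then (count (ltn^~ a) c' + inversions c')%N else 0%N.

Definition content p c : seq nat := [seq count_mem j c | j <- iota 0 p].

Fixpoint block_sorted lam c : bool :=
  if lam is l :: lam' then path leq 0 (take l c) && block_sorted lam' (drop l c)
  else true.

(** Undoes [incr_nth] at the positions a < size s of a content s. *)
Fixpoint decr_nth s a : seq nat :=
  if s is m :: s' then if a is a'.+1 then m :: decr_nth s' a' else m.-1 :: s'
  else [::].

Lemma mem_words p n c : (c \in words p n) = (size c == n) && all (ltn^~ p) c.
Proof.
elim: n c => [|n IH] [|a c] //=.
  by apply/negbTE/allpairsP => -[[x y] /= []].
apply/allpairsP/and3P => [[[x y] /= [+ + [-> ->]]]|[sz_c lt_a lt_c]].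
  by rewrite mem_iota IH add0n => /= lt_x /andP[/eqP-> ->].
by exists (a, c); rewrite /= mem_iota IH lt_a lt_c -eqSS sz_c.
Qed.

Lemma words_uniq p n : uniq (words p n).
Proof.
elim: n => //= n IH; apply: allpairs_uniq; rewrite ?iota_uniq //.
by move=> [a c] [a' c'] _ _ /= [-> ->].
Qed.

Lemma size_content p c : size (content p c) = p.
Proof. by rewrite size_map size_iota. Qed.

Lemma nth_content p c j : (j < p)%N -> nth 0%N (content p c) j = count_mem j c.
Proof. by move=> lt_jp; rewrite (nth_map 0%N) ?size_iota // nth_iota. Qed.

Lemma content_cons p a c : (a < p)%N ->
  content p (a :: c) = incr_nth (content p c) a.
Proof.
move=> lt_ap; apply: (@eq_from_nth _ 0%N) => [|j].
  by rewrite size_incr_nth !size_content lt_ap.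
by rewrite size_content => lt_jp; rewrite nth_incr_nth !nth_content.
Qed.

Lemma size_decr_nth s a : size (decr_nth s a) = size s.
Proof. by elim: s a => [|m s IH] [|a] //=; rewrite IH. Qed.

Lemma incr_nth_eq s mu a : size s = size mu -> (a < size mu)%N ->
  (incr_nth s a == mu) = (0 < nth 0 mu a)%N && (s == decr_nth mu a).
Proof.
elim: mu s a => [|m mu IH] [|x s] [|a] //= [sz] lt_a.
  by rewrite !eqseq_cons; case: m.
by rewrite !eqseq_cons IH // andbCA.
Qed.

Lemma sumn_take_decr_nth s a : sumn (take a (decr_nth s a)) = sumn (take a s).
Proof. by elim: s a => [|m s IH] [|a] //=; rewrite IH. Qed.

Lemma decr_nth_cat mu1 m mu2 :
  decr_nth (mu1 ++ m :: mu2) (size mu1) = mu1 ++ m.-1 :: mu2.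
Proof. by elim: mu1 => //= x mu1 ->. Qed.

Lemma sumn_content p c : sumn (content p c) = count (ltn^~ p) c.
Proof.
elim: p => [|p IH]; first by rewrite /= (eq_count (a2 := pred0)) ?count_pred0.
rewrite /content -[p.+1]addn1 iotaD map_cat sumn_cat IH /= addn0 addn1.
elim: c {IH} => //= x c <-.
rewrite addnCA !addnA -addnA [(x < p.+1)%N]ltnS leq_eqVlt.
by case: ltngtP => /=; lia.
Qed.

Lemma sumn_take_content p a c : (a <= p)%N ->
  sumn (take a (content p c)) = count (ltn^~ a) c.
Proof.
move=> le_ap; rewrite -sumn_content /content -map_take.
by rewrite take_iota (minn_idPl le_ap).
Qed.

End Words.

Section WordSum.
Variables (F : fieldType) (q : F).
Implicit Types (lam mu : seq nat) (a l : nat).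

Definition word_sum lam mu : F :=
  \sum_(c <- words (size mu) (sumn lam) |
      block_sorted lam c && (content (size mu) c == mu)) q ^+ inversions c.

(** The words of [word_sum] seen from inside the first block, where l letters are
    still to be read; they cannot be smaller than the last letter read, a. *)
Definition partial_word_sum l a lam mu : F :=
  \sum_(c <- words (size mu) (l + sumn lam) |
      [&& path leq a (take l c), block_sorted lam (drop l c)
        & content (size mu) c == mu]) q ^+ inversions c.

Lemma partial_word_sum0 a lam mu :
  partial_word_sum 0 a lam mu = word_sum lam mu.
Proof. by apply: eq_bigl => c; rewrite take0 drop0. Qed.

Lemma word_sum_cons l lam mu :
  word_sum (l :: lam) mu = partial_word_sum l 0 lam mu.
Proof. by apply: eq_bigl => c; rewrite /= andbA. Qed.

(** A first letter a is the left end of one inversion for each smaller letter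
    that comes later, and the content says how many there are. *)
Lemma partial_word_sumS l a0 lam mu :
  partial_word_sum l.+1 a0 lam mu =
    \sum_(a0 <= a < size mu | (0 < nth 0 mu a)%N)
      q ^+ sumn (take a mu) * partial_word_sum l a lam (decr_nth mu a).
Proof.
rewrite (big_nat_widenl _ 0) // /partial_word_sum addSn [words _ _.+1]/=.
rewrite [LHS]big_mkcond big_allpairs_dep.
rewrite /index_iota subn0 [RHS]big_mkcond /= big_seq [RHS]big_seq.
apply: eq_bigr => a; rewrite mem_iota add0n => /= lt_a.
rewrite -[LHS]big_mkcond /=.
have E c : (content (size mu) (a :: c) == mu) =
    (0 < nth 0 mu a)%N && (content (size mu) c == decr_nth mu a).
  by rewrite content_cons // incr_nth_eq ?size_content.
case: ifP => [/andP[mu_a le_a]|not_a].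
  rewrite size_decr_nth mulr_sumr; apply: eq_big => [c|c].
    by rewrite E le_a mu_a.
  rewrite E => /and3P[_ _ /andP[_ /eqP eq_c]].
  rewrite -exprD; congr (_ ^+ (_ + _)).
  by rewrite -(sumn_take_content c (ltnW lt_a)) eq_c sumn_take_decr_nth.
rewrite big1 // => c; rewrite E => /and3P[/andP[le_a _] _ /andP[mu_a _]].
by rewrite mu_a le_a in not_a.
Qed.

(** The letters still allowed in the current block are those of mu2.  Each of
    the l letters to be read is thus larger than the sumn mu1 letters of mu1, which
    all come in later blocks; this explains the exponent l * sumn mu1. *)
Lemma partial_word_sumE l lam mu1 mu2 :
  partial_word_sum l (size mu1) lam (mu1 ++ mu2) =
    q ^+ (l * sumn mu1) * row_sum q mu2 l (fun s => word_sum lam (mu1 ++ s)).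
Proof.
elim: l mu1 mu2 => [|l IHl] mu1 mu2.
  by rewrite partial_word_sum0 row_sum_nil mul1r.
elim: mu2 mu1 => [|m mu2 IHm] mu1.
  by rewrite partial_word_sumS cats0 big_geq //= mulr0.
rewrite partial_word_sumS row_sumS size_cat /= big_ltn_cond; last by lia.
(* The letters after the first admissible one form the same sum for the cut
   moved one column to the right. *)
have := IHm (rcons mu1 m).
rewrite size_rcons cat_rcons partial_word_sumS size_cat /= => ->.
rewrite nth_cat ltnn subnn /= take_size_cat // sumn_rcons.
under [in LHS]eq_row_sum do rewrite cat_rcons.
rewrite [LHS](_ : _ = q ^+ (l.+1 * (sumn mu1 + m)) *
    row_sum q mu2 l.+1 (fun s => word_sum lam (mu1 ++ m :: s)) +
    (if (0 < m)%N then q ^+ sumn mu1 *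
      partial_word_sum l (size mu1) lam (decr_nth (mu1 ++ m :: mu2) (size mu1))
    else 0)); last by case: ifP => _; [exact: addrC | rewrite addr0].
rewrite mulrDr mulrA -exprD -mulnDr; congr (_ + _).
case: m => [|m] /=; first by rewrite mulr0.
by rewrite decr_nth_cat IHl mulrA -exprD mulSn.
Qed.

Lemma word_sumE lam mu : word_sum lam mu = matrix_sum q lam mu.
Proof.
elim: lam mu => [|l lam IH] mu.
  rewrite /word_sum /= big_cons big_nil /= addr0.
  rewrite (_ : (content _ _ == mu) = (sumn mu == 0%N)); first by case: eqP.
  have -> : content (size mu) [::] = nseq (size mu) 0%N.
    apply: (@eq_from_nth _ 0%N); rewrite size_content ?size_nseq // => j lt_j.
    by rewrite nth_content // nth_nseq lt_j.
  by elim: mu => //= m mu IHm; rewrite eqseq_cons IHm addn_eq0 [in LHS]eq_sym.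
rewrite word_sum_cons (partial_word_sumE l lam [::] mu) muln0 mul1r.
by apply: eq_row_sum => s _; rewrite IH.
Qed.

End WordSum.

(** * Double cosets of Young subgroups *)

Section Permutations.
Variable N : nat.
Implicit Types (s w : 'S_N) (d f : 'I_N -> nat).

Definition monotone f := forall x y : 'I_N, (x <= y)%N -> (f x <= f y)%N.

(** The sublevel sets of a monotone function are initial segments. *)
Lemma monotone_ltn f z j : monotone f ->
  (f z < j)%N = (z < #|[set y | (f y < j)%N]|)%N.
Proof.
move=> mono_f.
have card_ord k : (k <= N)%N -> #|[set y : 'I_N | (y < k)%N]| = k.
  move=> le_kN; rewrite -sum1_card; under eq_bigl do rewrite inE.
  by rewrite -(big_ord_widen _ (fun=> 1%N)) // sum1_card card_ord.
apply/idP/idP => [lt_fz|]; last (apply: contraTT; rewrite -!leqNgt).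
  rewrite -[X in (X <= _)%N](card_ord z.+1) //; apply: subset_leq_card.
  by apply/subsetP => y; rewrite !inE ltnS => /mono_f/leq_ltn_trans; apply.
move=> le_j; rewrite -[X in (_ <= X)%N](card_ord z (ltnW (ltn_ord z))).
apply: subset_leq_card; apply/subsetP => y; rewrite !inE => lt_fy.
by rewrite ltnNge; apply/negP => /mono_f le_f; lia.
Qed.

(** A rearrangement does not change the sizes of the sublevel sets, which
    determine a monotone function: this gives the uniqueness of sorted
    rearrangements. *)
Lemma monotone_perm f s : monotone f -> monotone (f \o s) -> f \o s =1 f.
Proof.
move=> mono_f mono_fs z.
have E j : (f (s z) < j)%N = (f z < j)%N.
  rewrite (monotone_ltn z j mono_f) (monotone_ltn z j mono_fs); congr (_ < _)%N.
  rewrite -(card_imset _ (@perm_inj _ s)); apply: eq_card => y.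
  rewrite inE; apply/imsetP/idP => [[x + ->]|fy]; first by rewrite inE.
  by exists (s^-1 y)%g; rewrite ?inE /= permKV.
by apply/eqP; rewrite eqn_leq -ltnS E ltnSn /= -ltnS -E ltnSn.
Qed.

Definition key_lt f (x y : 'I_N) : bool :=
  (f x < f y)%N || ((f x == f y) && (x < y)%N).

(** Stable sorting: a position is sent to its rank in the order [key_lt f]. *)
Lemma rank_perm f : exists s, forall x y, (s x < s y)%N = key_lt f x y.
Proof.
pose R x := [set y | key_lt f y x].
have Rlt x : (#|R x| < N)%N.
  rewrite -[X in (_ < X)%N]card_ord -cardsT; apply: proper_card.
  apply/properP; split; first exact: subsetT.
  by exists x; rewrite ?inE // /key_lt ltnn eqxx ltnn.
have Rmono x y : key_lt f x y -> (#|R x| < #|R y|)%N.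
  move=> lt_xy; apply: proper_card; apply/properP; split.
    by apply/subsetP => z; move: lt_xy; rewrite !inE /key_lt; lia.
  by exists x; rewrite ?inE // /key_lt; lia.
have key_total x y : x != y -> key_lt f x y || key_lt f y x.
  move=> /eqP ne; rewrite /key_lt.
  by have : (x : nat) <> y by [move/val_inj]; lia.
have Rinj : injective (fun x => Ordinal (Rlt x)).
  move=> x y [eqR]; apply/eqP; apply/negPn/negP => /key_total/orP[]/Rmono;
  by rewrite eqR ltnn.
exists (perm Rinj) => x y; rewrite !permE /=.
apply/idP/idP => [lt_R|]; last exact: Rmono.
have [eq_xy|/key_total/orP[//|/Rmono]] := eqVneq x y; last first.
  by move/(ltn_trans lt_R); rewrite ltnn.
by rewrite eq_xy ltnn in lt_R.
Qed.

Lemma rank_perm_monotone f s : (forall x y, (s x < s y)%N = key_lt f x y) ->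
  monotone (f \o (s^-1)%g).
Proof.
move=> sP x y; rewrite leqNgt -{1}(permKV s x) -{1}(permKV s y) sP /key_lt /=.
lia.
Qed.

Lemma inversionsE (c : seq nat) : size c = N -> inversions c =
  #|[set p : 'I_N * 'I_N | (p.1 < p.2)%N && (nth 0 c p.2 < nth 0 c p.1)%N]|.
Proof.
move=> <-; rewrite -sum1_card.
under eq_bigl do rewrite inE.
rewrite -(pair_big_dep xpredT (fun i j : 'I_(size c) =>
  (i < j)%N && (nth 0 c j < nth 0 c i)%N) (fun _ _ => 1%N)) /=.
elim: c => [|a c IH] /=; first by rewrite big_ord0.
rewrite big_ord_recl /=; congr addn.
  rewrite big_mkcond big_ord_recl /= add0n -sum1_count (big_nth 0%N) big_mkord.
  by rewrite [LHS]big_mkcond.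
rewrite IH; apply: eq_bigr => i _.
by rewrite [RHS]big_mkcond big_ord_recl /= add0n [LHS]big_mkcond.
Qed.

End Permutations.

Lemma reshape_index_cons m (nu : seq nat) i : reshape_index (m :: nu) i =
  if (i < m)%N then 0%N else (reshape_index nu (i - m)).+1.
Proof.
by rewrite /reshape_index /= subn_eq0; case: ltnP => // le_mi; rewrite subSn.
Qed.

Lemma path_leq0 (c : seq nat) : path leq 0 c = sorted leq c.
Proof. by case: c. Qed.

Lemma block_sortedP (lam c : seq nat) : size c = sumn lam ->
  (forall x y, (x <= y < size c)%N ->
     reshape_index lam x = reshape_index lam y ->
     (nth 0 c x <= nth 0 c y)%N) <-> block_sorted lam c.
Proof.
elim: lam c => [|l lam IH] c sz_c.
  by split=> // _ x y; rewrite sz_c ltn0 andbF.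
have sz_t : size (take l c) = l by rewrite size_take_min sz_c /=; lia.
have sz_d : size (drop l c) = sumn lam by rewrite size_drop sz_c addKn.
have {IH} [IH1 IH2] := IH _ sz_d.
rewrite /= path_leq0; split=> [sort_c|/andP[sort_t /IH2 sort_d] x y].
  apply/andP; split.
    apply/(sortedP 0%N) => i; rewrite sz_t => lt_i.
    rewrite !nth_take ?(ltnW lt_i) //.
    apply: sort_c; first by rewrite sz_c leqnSn /=; lia.
    by rewrite !reshape_index_cons lt_i (ltnW lt_i).
  apply: IH1 => x y; rewrite sz_d => /andP[le_xy lt_y] eq_xy; rewrite !nth_drop.
  apply: sort_c; first by rewrite sz_c leq_add2l le_xy ltn_add2l.
  by rewrite !reshape_index_cons !ltnNge !leq_addr !addKn eq_xy.
rewrite !reshape_index_cons sz_c => /andP[le_xy lt_y].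
case: (ltnP y l) => [lt_yl|le_ly];
  case: (ltnP x l) => [lt_xl|le_lx] //; try by lia.
  move=> _; rewrite -(nth_take 0%N lt_xl) -(nth_take 0%N lt_yl).
  by apply: (sorted_leq_nth leq_trans leqnn) => //; rewrite inE sz_t.
move=> [eq_xy]; rewrite -(subnKC le_lx) -(subnKC le_ly) -!nth_drop.
by apply: sort_d => //; rewrite sz_d; move: lt_y => /=; lia.
Qed.

Section DoubleCosetWords.
Variables (N : nat) (lam mu : seq nat).
Hypotheses (sum_lam : sumn lam = N) (sum_mu : sumn mu = N).
Implicit Types (s w : 'S_N) (c : seq nat).

Let row_of (x : 'I_N) := reshape_index lam x.
Let col_of (x : 'I_N) := reshape_index mu x.

Definition perm_word w : seq nat := [seq col_of (w x) | x <- enum 'I_N].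

Definition good_word c : bool :=
  (c \in words (size mu) N) &&
    (block_sorted lam c && (content (size mu) c == mu)).

(** The double coset attached to c; it is described by membership, so that no
    permutation with word c has to be chosen. *)
Definition word_coset c : {set 'S_N} :=
  [set w | [exists s in young N lam, perm_word (s * w)%g == c]].

Lemma reshape_index_monotone (nu : seq nat) :
  monotone (fun x : 'I_N => reshape_index nu x).
Proof.
by move=> x y; rewrite (reshape_leq nu) => /orP[/ltnW|/andP[/eqP->]].
Qed.

Lemma nth_perm_word w (x : 'I_N) : nth 0%N (perm_word w) x = col_of (w x).
Proof. by rewrite (nth_map x) ?nth_ord_enum // size_enum_ord. Qed.

Lemma size_perm_word w : size (perm_word w) = N.
Proof. by rewrite size_map size_enum_ord. Qed.

Lemma perm_wordP w c : size c = N ->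
  perm_word w = c <-> forall x, col_of (w x) = nth 0%N c x.
Proof.
move=> sz_c; split=> [<- x|E]; first by rewrite nth_perm_word.
apply: (@eq_from_nth _ 0%N); rewrite size_perm_word // => k lt_k.
by rewrite -[k]/(nat_of_ord (Ordinal lt_k)) nth_perm_word E.
Qed.

Lemma col_lt x : (col_of x < size mu)%N.
Proof. by apply: reshape_indexP; rewrite sum_mu. Qed.

Lemma perm_word_mem w : perm_word w \in words (size mu) N.
Proof.
rewrite mem_words size_perm_word eqxx /=; apply/allP => _ /mapP[x _ ->].
exact: col_lt.
Qed.

Lemma content_reshape_index (nu : seq nat) :
  content (size nu) [seq reshape_index nu i | i <- iota 0 (sumn nu)] = nu.
Proof.
apply: (@eq_from_nth _ 0%N); rewrite size_content // => j lt_j.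
rewrite nth_content // {lt_j}; elim: nu j => [|m nu IH] j /=.
  by rewrite nth_nil.
rewrite iotaD map_cat count_cat add0n.
have -> : iota m (sumn nu) = [seq (m + i)%N | i <- iota 0 (sumn nu)].
  by rewrite -iotaDl addn0.
rewrite -map_comp.
rewrite (@eq_in_map _ _ _ (fun=> 0%N) (iota 0 m)).1 => [|i]; last first.
  by rewrite mem_iota reshape_index_cons => /andP[_ ->].
rewrite (@eq_map _ _ _ (succn \o reshape_index nu)) => [|i]; last first.
  by rewrite /= reshape_index_cons ltnNge leq_addr addKn.
rewrite map_comp !count_map; case: j => [|j] /=.
  rewrite (eq_count (a2 := predT)) // count_predT size_iota.
  by rewrite (eq_count (a2 := pred0)) // count_pred0 addn0.
rewrite (eq_count (a2 := pred0)) // count_pred0 add0n -IH count_map.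
by apply: eq_count => i.
Qed.

Lemma perm_word1 : perm_word 1 = [seq reshape_index mu i | i <- iota 0 N].
Proof.
rewrite -val_enum_ord -map_comp; apply: eq_map => x /=.
by rewrite perm1.
Qed.

Lemma perm_word_perm_eq w : perm_eq (perm_word w) (perm_word 1).
Proof.
rewrite /perm_word [X in perm_eq X](map_comp col_of w).
rewrite [X in perm_eq _ X](map_comp col_of (1%g : 'S_N)); apply: perm_map.
rewrite (eq_map (perm1 (T := _))) map_id; apply: uniq_perm.
- by rewrite map_inj_uniq ?enum_uniq //; exact: perm_inj.
- exact: enum_uniq.
by move=> x; rewrite mem_enum -(permKV w x) map_f ?mem_enum.
Qed.

Lemma content_perm_word w : content (size mu) (perm_word w) = mu.
Proof.
rewrite -[RHS]content_reshape_index sum_mu -perm_word1; apply: eq_map => j.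
exact: (elimT seq.permP (perm_word_perm_eq w)) (pred1 j).
Qed.



(** A word of content mu is a rearrangement of the word of the identity. *)
Lemma good_wordP c : good_word c -> exists w, perm_word w = c.
Proof.
rewrite /good_word mem_words.
move=> /andP[/andP[/eqP sz_c /allP lt_c] /andP[_ /eqP cont_c]].
have sz1 := size_perm_word 1.
have : perm_eq c (tcast sz1 (in_tuple (perm_word 1))).
  rewrite val_tcast /=; apply/allP => j _ /=; apply/eqP.
  have [lt_j|le_j] := ltnP j (size mu).
    rewrite -(nth_content _ lt_j) cont_c -{1}(content_perm_word 1).
    by rewrite nth_content.
  rewrite [LHS](count_memPn _) ?[RHS](count_memPn _) //; apply: contraTN le_j.
    by move=> /mapP[x _ ->]; rewrite -ltnNge col_lt.
  by move=> /lt_c; rewrite -ltnNge.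
move=> /tuple_permP[p eq_c]; exists p.
apply/perm_wordP => // x.
rewrite eq_c (nth_map x) ?size_enum_ord // nth_ord_enum.
by rewrite (tnth_nth 0%N) val_tcast /= nth_perm_word perm1.
Qed.

Lemma perm_length_rank w (f : 'I_N -> nat) :
  (forall x y, (w x < w y)%N = key_lt f x y) ->
  perm_length w = #|[set p : 'I_N * 'I_N | (p.1 < p.2)%N && (f p.2 < f p.1)%N]|.
Proof.
move=> wP; apply: eq_card => -[x y]; rewrite !inE /= wP /key_lt.
by case: ltnP => //= lt_xy; lia.
Qed.

(** The stable sorting permutation of c has word c, by uniqueness of sorted
    rearrangements, and no inversion between equal letters. *)
Lemma good_word_min c : good_word c ->
  exists w, perm_word w = c /\ perm_length w = inversions c.
Proof.
move=> good_c; have [p p_c] := good_wordP good_c.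
have [w wP] := rank_perm (col_of \o p).
have sz_c : size c = N by rewrite -p_c size_perm_word.
have mono_col : monotone col_of by exact: reshape_index_monotone.
have E : col_of \o (w^-1 * p)%g =1 col_of.
  apply: monotone_perm => // x y /(rank_perm_monotone wP) /=.
  by rewrite !permM.
have Ew x : col_of (w x) = col_of (p x) by rewrite -(E (w x)) /= permM permK.
exists w; split.
  by apply/perm_wordP => // x; rewrite Ew -p_c nth_perm_word.
rewrite (perm_length_rank wP) (inversionsE sz_c); apply: eq_card => -[x y].
by rewrite !inE /= -p_c !nth_perm_word.
Qed.

Lemma young_row s (x : 'I_N) : s \in young N lam -> row_of (s x) = row_of x.
Proof. by rewrite inE => /forallP/(_ x)/eqP. Qed.

Lemma block_sorted_permP w : block_sorted lam (perm_word w) <->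
  forall x y : 'I_N, (x <= y)%N -> row_of x = row_of y ->
    (col_of (w x) <= col_of (w y))%N.
Proof.
have sz : size (perm_word w) = sumn lam by rewrite size_perm_word sum_lam.
apply: iff_trans (iff_sym (block_sortedP sz)) _; rewrite size_perm_word; split.
  move=> sort_w x y le_xy eq_xy; rewrite -!nth_perm_word.
  by apply: sort_w; rewrite ?le_xy ?ltn_ord.
move=> sort_w x y /andP[le_xy lt_y] eq_xy.
have lt_x := leq_ltn_trans le_xy lt_y.
rewrite -[x]/(nat_of_ord (Ordinal lt_x)) -[y]/(nat_of_ord (Ordinal lt_y)).
by rewrite !nth_perm_word; apply: sort_w.
Qed.

(** The pair (row, letter) as one number, in lexicographic order: words sorted
    inside the blocks are those for which this function is monotone. *)
Definition row_col w (x : 'I_N) := (row_of x * size mu + col_of (w x))%N.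

Lemma row_col_row w x : (row_col w x %/ size mu)%N = row_of x.
Proof.
have lt_c := col_lt (w x).
by rewrite /row_col divnMDl ?divn_small ?addn0 //; apply: leq_ltn_trans lt_c.
Qed.

Lemma row_col_monotone w : block_sorted lam (perm_word w) -> monotone (row_col w).
Proof.
move=> /block_sorted_permP sort_w x y le_xy; rewrite /row_col.
have := reshape_index_monotone lam le_xy.
rewrite -/(row_of x) -/(row_of y) leq_eqVlt.
case/orP => [/eqP eq_xy|lt_xy]; first by rewrite eq_xy leq_add2l sort_w.
have := leq_mul lt_xy (leqnn (size mu)); have := col_lt (w x); rewrite mulSn.
lia.
Qed.

Lemma exists_block_sorted w :
  exists2 s, s \in young N lam & block_sorted lam (perm_word (s * w)%g).
Proof.
have [r rP] := rank_perm (row_col w); have mono_r := rank_perm_monotone rP.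
have E : row_of \o (r^-1)%g =1 row_of.
  apply: monotone_perm => [|x y /mono_r le_xy].
    exact: reshape_index_monotone.
  by rewrite /= -(row_col_row w) -[leqRHS](row_col_row w) leq_div2r.
exists (r^-1)%g; first by rewrite inE; apply/forallP => x; apply/eqP; apply: E.
apply/block_sorted_permP => x y /mono_r /=; rewrite /row_col !permM.
have /= -> := E x; have /= -> := E y => le_xy eq_xy.
by rewrite eq_xy leq_add2l in le_xy.
Qed.

Lemma good_word_inj c c' s w :
  good_word c -> good_word c' -> s \in young N lam ->
  perm_word w = c -> perm_word (s * w)%g = c' -> c' = c.
Proof.
move=> /and3P[_ sort_c _] /and3P[_ sort_c' _] young_s w_c sw_c'; subst c c'.
have E x : row_col (s * w)%g x = row_col w (s x).
  by rewrite /row_col (young_row _ young_s) permM.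
have eq_rc : row_col w \o s =1 row_col w.
  apply: monotone_perm; first exact: row_col_monotone.
  by move=> x y /(row_col_monotone sort_c'); rewrite !E.
apply/perm_wordP; rewrite ?size_perm_word // => x; rewrite nth_perm_word permM.
by have := eq_rc x; rewrite /= /row_col (young_row _ young_s) => /addnI.
Qed.

Lemma perm_word_young w w' :
  (perm_word w == perm_word w') = (w^-1 * w' \in young N mu)%g.
Proof.
rewrite inE; apply/eqP/forallP => [eq_w z|young_w].
  rewrite permM -/(col_of _) -/(col_of z) -nth_perm_word -eq_w nth_perm_word.
  by rewrite permKV.
apply/perm_wordP; rewrite ?size_perm_word // => x; rewrite nth_perm_word.
by have /eqP := young_w (w x); rewrite permM permK.
Qed.

Lemma word_cosetE w :
  word_coset (perm_word w) = (young N lam * [set w] * young N mu)%g.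
Proof.
apply/setP => v; rewrite inE; apply/existsP/mulsgP.
  move=> [s /andP[young_s]]; rewrite eq_sym perm_word_young => young_t.
  exists (s^-1 * w)%g (w^-1 * (s * v))%g => //.
    by rewrite mem_mulg ?set11 // (groupVr (G := young_group N lam)).
  by rewrite mulgA mulgK mulKg.
move=> [_ t /mulsgP[s _ young_s /set1P-> ->] young_t ->].
exists (s^-1)%g; rewrite (groupVr (G := young_group N lam)) //= eq_sym.
by rewrite perm_word_young !mulgA mulgVK mulVg mul1g.
Qed.

(** Two letters of c that form an inversion lie in different rows, so they keep
    their relative order when positions are permuted inside the rows: every
    permutation in the double coset has at least as many inversions as c, and
    [good_word_min] gives equality. *)
Lemma min_rep_word_coset c : good_word c ->
  perm_length (min_rep (word_coset c)) = inversions c.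
Proof.
move=> good_c; have [w [w_c len_w]] := good_word_min good_c.
have sz_c : size c = N by rewrite -w_c size_perm_word.
have dc : word_coset c \in double_cosets N lam mu.
  by rewrite -w_c word_cosetE; apply: imset_f.
have [] := min_repP dc; set m := min_rep _ => m_c min_m.
apply/eqP; rewrite eqn_leq; apply/andP; split.
  rewrite -len_w min_m // inE; apply/existsP; exists 1%g.
  by rewrite (group1 (young_group N lam)) mul1g w_c /=.
move: m_c; rewrite inE => /existsP[s /andP[young_s /eqP sm_c]].
have c_col (x : 'I_N) : nth 0%N c x = col_of (m (s x)).
  by rewrite -sm_c nth_perm_word permM.
have sort_c (x y : 'I_N) : (x <= y)%N -> row_of x = row_of y ->
    (nth 0 c x <= nth 0 c y)%N.
  case/and3P: good_c => _; rewrite -{1}sm_c => /block_sorted_permP sort_c _.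
  by move=> le_xy /(sort_c x y le_xy); rewrite !permM -!c_col.
rewrite (inversionsE sz_c).
pose g (p : 'I_N * 'I_N) := (s p.1, s p.2).
have g_inj : injective g by move=> [x y] [x' y'] [/perm_inj-> /perm_inj->].
rewrite -(card_imset _ g_inj); apply: subset_leq_card.
apply/subsetP => _ /imsetP[[x y] + ->]; rewrite !inE /= => /andP[lt_xy lt_c].
have lt_row : (row_of (s x) < row_of (s y))%N.
  rewrite !(young_row _ young_s) ltn_neqAle reshape_index_monotone 1?ltnW //.
  rewrite andbT.
  by apply/eqP => /(sort_c x y (ltnW lt_xy)); rewrite leqNgt lt_c.
apply/andP; split.
  rewrite ltnNge; apply: contraL lt_row => /(reshape_index_monotone lam).
  by rewrite -leqNgt.
rewrite ltnNge; apply: contraL lt_c => /(reshape_index_monotone mu).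
by rewrite -leqNgt !c_col.
Qed.

Lemma word_coset_perm_eq :
  perm_eq
    [seq word_coset c | c <- words (size mu) N &
      block_sorted lam c && (content (size mu) c == mu)]
    (enum (double_cosets N lam mu)).
Proof.
have good_in c : c \in [seq c <- words (size mu) N |
    block_sorted lam c && (content (size mu) c == mu)] -> good_word c.
  by rewrite mem_filter /good_word andbC.
apply: uniq_perm; rewrite ?enum_uniq //.
  rewrite map_inj_in_uniq ?filter_uniq ?words_uniq //.
  move=> c c' /good_in good_c /good_in good_c' eq_cc'.
  have [w w_c] := good_wordP good_c.
  have : w \in word_coset c'.
    rewrite -eq_cc' inE; apply/existsP; exists 1%g.
    by rewrite (group1 (young_group N lam)) mul1g w_c /=.
  rewrite inE => /existsP[s /andP[young_s /eqP sw_c']].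
  by apply: esym; apply: good_word_inj good_c good_c' young_s w_c sw_c'.
move=> C; rewrite mem_enum.
apply/mapP/imsetP => [[c /good_in good_c ->]|[w _ ->]].
  by have [w <-] := good_wordP good_c; exists w; rewrite // word_cosetE.
have [s young_s sort_sw] := exists_block_sorted w.
exists (perm_word (s * w)%g).
  by rewrite mem_filter perm_word_mem sort_sw content_perm_word eqxx.
rewrite word_cosetE; congr (_ * _)%g; apply/setP => v.
apply/mulsgP/mulsgP => -[s' _ young_s' /set1P-> ->].
  exists (s' * s^-1)%g (s * w)%g; rewrite ?set11 ?mulgA ?mulgVK //.
  rewrite (groupM (G := young_group N lam)) //.
  by rewrite (groupVr (G := young_group N lam)).
exists (s' * s)%g w; rewrite ?set11 ?mulgA //.
by rewrite (groupM (G := young_group N lam)).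
Qed.

End DoubleCosetWords.

Lemma form_compE (F : fieldType) (q : F) (lam mu : seq nat) :
  form_comp q lam mu = matrix_sum q lam mu.
Proof.
rewrite /form_comp; case: eqP => [eq_sum|/eqP ne_sum]; last first.
  by rewrite matrix_sum_neq.
rewrite -word_sumE /word_sum -big_enum /=.
rewrite -(perm_big _ (word_coset_perm_eq (erefl (sumn lam)) (esym eq_sum))) /=.
rewrite big_map big_filter big_seq_cond [RHS]big_seq_cond.
apply: eq_bigr => c good_c.
by rewrite (min_rep_word_coset (erefl _) (esym eq_sum)).
Qed.

(** * Functionals on the twisted tensor square *)

Section RowSumBig.
Variables (F : fieldType) (q : F).

Lemma row_sum_big (T : Type) (r : seq T) (c : T -> F)
    (K : T -> seq nat -> F) mu l :
  row_sum q mu l (fun s => \sum_(i <- r) c i * K i s) =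
    \sum_(i <- r) c i * row_sum q mu l (K i).
Proof.
elim: r => [|i r IH].
  rewrite big_nil -[RHS](row_sum_0 q mu l).
  by apply: eq_row_sum => s _; rewrite big_nil.
rewrite big_cons -IH -row_sum_linear.
by apply: eq_row_sum => s _; rewrite big_cons.
Qed.

Lemma matrix_sum_nil lam : matrix_sum q lam [::] = (sumn lam == 0%N)%:R.
Proof.
elim: lam => [|l lam IH] //; rewrite matrix_sum_cons /= IH addn_eq0.
by case: eqP.
Qed.

End RowSumBig.

Section IsLinear.
Variables (F : fieldType) (U V : lmodType F) (f : U -> V).
Hypothesis lin_f : linear f.

Lemma is_linear0 : f 0 = 0.
Proof. by have := lin_f (-1) 0 0; rewrite scaler0 addr0 scaleN1r addNr. Qed.

Lemma is_linearZ c x : f (c *: x) = c *: f x.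
Proof. by have := lin_f c x 0; rewrite !addr0 is_linear0 addr0. Qed.

Lemma is_linear_sum n (g : 'I_n -> U) : f (\sum_i g i) = \sum_i f (g i).
Proof.
apply: (big_morph f _ is_linear0) => x y.
by have := lin_f 1 x y; rewrite !scale1r.
Qed.

End IsLinear.

Section FreeMonoid.

Lemma word_ind (P : word -> Prop) :
  P mone -> (forall i w, P w -> P (mmul (fmu i) w)) -> forall w, P w.
Proof.
move=> P1 PM [s]; elim: s => [|i s /(PM i)].
  by congr P: P1; apply/eqP; rewrite fmP fm1.
by congr P; apply/eqP; rewrite fmP fmM fmuE.
Qed.

Lemma parts1 : parts mone = [::].
Proof. by rewrite /parts fm1. Qed.

Lemma partsM u v : parts (mmul u v) = parts u ++ parts v.
Proof. by rewrite /parts fmM map_cat. Qed.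

Lemma parts_consM i w : parts (mmul (fmu i) w) = i.+1 :: parts w.
Proof. by rewrite /parts fmM fmuE. Qed.

Lemma wdeg_eq0 (w : word) : (wdeg w == 0%N) = ((w : seq nat) == [::]).
Proof. by rewrite /wdeg /parts; case: (w : seq nat). Qed.

Lemma wdeg_nseq (w : word) k : (w : seq nat) = nseq k 0%N -> wdeg w = k.
Proof. by rewrite /wdeg /parts => ->; elim: k => //= k ->. Qed.

Definition hword m : word := if m is m'.+1 then fmu m' else mone.

Lemma wdeg_hwordM m w : wdeg (mmul (hword m) w) = (m + wdeg w)%N.
Proof. by case: m => [|m]; rewrite /wdeg /= ?mul1m // parts_consM. Qed.

End FreeMonoid.

Section Pairing.
Variables (F : fieldType) (q : F).
Implicit Types (psi : word * word -> F) (t : NLam2 F).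

Lemma hE m : h m%:Z = << hword m >> :> NLam F.
Proof. by case: m. Qed.

(** The linear functional on NLam (x) NLam with values psi on the basis; its
    codomain is F as a module over itself. *)
Definition evaluate psi t : F := @lin_ext F (word * word)%type F^o psi t.

Lemma evaluateE psi t : evaluate psi t = \sum_(k <- msupp t) t@_k * psi k.
Proof. exact: (@lin_extE F _ F^o). Qed.

Lemma evaluateU psi ab : evaluate psi << ab >> = psi ab.
Proof. exact: (@lin_extU F _ F^o). Qed.

Lemma eq_evaluate psi1 psi2 t :
  psi1 =1 psi2 -> evaluate psi1 t = evaluate psi2 t.
Proof. by move=> eq_psi; apply: (eq_lin_ext (V := F^o)). Qed.

Lemma evaluateZ c psi t :
  evaluate (fun ab => c * psi ab) t = c * evaluate psi t.
Proof.
by rewrite !evaluateE mulr_sumr; apply: eq_bigr => k _; rewrite mulrCA.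
Qed.

Lemma evaluate0 t : evaluate (fun=> 0) t = 0.
Proof. by rewrite evaluateE big1 // => k _; rewrite mulr0. Qed.

Lemma evaluate_linear psi : linear (evaluate psi : NLam2 F -> F^o).
Proof. exact: (@lin_ext_is_linear F _ F^o). Qed.

Lemma row_sum_evaluate (psi : seq nat -> word * word -> F) mu l t :
  row_sum q mu l (fun s => evaluate (psi s) t) =
    evaluate (fun ab => row_sum q mu l (psi^~ ab)) t.
Proof.
rewrite evaluateE -row_sum_big.
by apply: eq_row_sum => s _; rewrite evaluateE.
Qed.

Lemma Delta_hwordE l :
  Delta_h F l = \sum_(j < l.+1) << (hword j, hword (l - j)) >>.
Proof.
apply: eq_bigr => j _; rewrite -tensorU -!hE.
by rewrite subzn // -ltnS.
Qed.

(** All later arguments split off the first part of a composition through this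
    expansion of the twisted product. *)
Lemma evaluate_Delta_h psi l t :
  evaluate psi (tmul q (Delta_h F l) t) =
    \sum_(j < l.+1) evaluate (fun ab => q ^+ ((l - j) * wdeg ab.1) *
      psi (mmul (hword j) ab.1, mmul (hword (l - j)) ab.2)) t.
Proof.
have lin1 : linear (fun s => evaluate psi (tmul q s t) : F^o).
  exact: (linear_comp (evaluate_linear psi) (tmul_linearl q t)).
rewrite Delta_hwordE (is_linear_sum lin1); apply: eq_bigr => j _.
apply: (@eq_on_basis F _ F^o
  (evaluate psi \o tmul q << (hword j, hword (l - j)) >>)
  (evaluate _)) => [||ab].
- exact: linear_comp (evaluate_linear psi) (tmul_linearr q _).
- exact: evaluate_linear.
rewrite /= tmulU evaluateU (is_linearZ (evaluate_linear psi)).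
rewrite evaluateU; congr (q ^+ (_ * _) * _).
by have := wdeg_hwordM (l - j) mone; rewrite mulm1 /wdeg parts1 addn0.
Qed.

Lemma Delta_word1 : Delta_word q mone = << (mone, mone) >>.
Proof. by rewrite /Delta_word parts1 big_nil -tensorU. Qed.

Lemma Delta_word_consM i w :
  Delta_word q (mmul (fmu i) w) = tmul q (Delta_h F i.+1) (Delta_word q w).
Proof. by rewrite Delta_wordM -(Delta_hE q i.+1) /Delta lin_extU. Qed.

Lemma matrix_sum_hwordM j u mu :
  matrix_sum q (parts (mmul (hword j) u)) mu =
    row_sum q mu j (matrix_sum q (parts u)).
Proof. by case: j => [|j]; rewrite /= ?mul1m ?row_sum_nil // parts_consM. Qed.

(** Adjointness on the basis: cutting a matrix after the columns of mu splits
    every part of the composition, as Delta does. *)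
Lemma matrix_sum_cat w mu nu :
  matrix_sum q (parts w) (mu ++ nu) =
    evaluate
      (fun ab => matrix_sum q (parts ab.1) mu * matrix_sum q (parts ab.2) nu)
      (Delta_word q w).
Proof.
elim/word_ind: w mu nu => [|i w IH] mu nu.
  rewrite Delta_word1 evaluateU parts1 /= sumn_cat addn_eq0 -natrM.
  by case: eqP; case: eqP.
rewrite Delta_word_consM evaluate_Delta_h parts_consM matrix_sum_cons.
rewrite row_sum_cat.
apply: eq_bigr => j _.
under eq_row_sum do under eq_row_sum do rewrite IH.
under eq_row_sum do rewrite row_sum_evaluate.
rewrite row_sum_evaluate -evaluateZ; apply: eq_evaluate => -[u v] /=.
rewrite !matrix_sum_hwordM.
under eq_row_sum do rewrite row_sumZ mulrC.
rewrite row_sumZ [_ * row_sum _ mu _ _]mulrC !mulrA; congr (_ * _).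
(* The twist sees deg u where the matrices have sumn mu - j; the two agree
   unless the sum over the rows of u vanishes. *)
have [eq_deg|ne_deg] := eqVneq (sumn ((j : nat) :: parts u)) (sumn mu).
  by rewrite -eq_deg /= addKn.
by rewrite -!matrix_sum_cons matrix_sum_neq ?mulr0.
Qed.

Lemma hformU u v : hform q << u >> << v >> = matrix_sum q (parts u) (parts v).
Proof. by rewrite /hform !lin_extU form_compE. Qed.

Lemma hform_linearr x : linear (hform q x : NLam F -> F^o).
Proof.
move=> c y1 y2; rewrite /hform -lin_ext_fun_linear.
by apply: eq_lin_ext => u; exact: lin_ext_is_linear.
Qed.

Lemma hform0r x : hform q x 0 = 0.
Proof. exact: is_linear0 (hform_linearr x). Qed.

Lemma hform_sumZr x n (c : 'I_n -> F) (y : 'I_n -> NLam F) :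
  hform q x (\sum_i c i *: y i) = \sum_i c i * hform q x (y i).
Proof.
apply: etrans (is_linear_sum (hform_linearr x) _) _.
by apply: eq_bigr => i _; apply: (is_linearZ (hform_linearr x)).
Qed.

Lemma mul_linearl (y : NLam F) : linear (fun x => x * y).
Proof. by move=> c u v; rewrite mulrDl scalerAl. Qed.

Lemma mul_linearr (x : NLam F) : linear ( *%R x).
Proof.
move=> c u v; rewrite mulrDr; congr (_ + _).
rewrite [LHS](fgmullw (fsubset_refl _) (msuppZ_le _ _)) scaler_sumr.
apply: eq_bigr => k _; rewrite scaler_sumr; apply: eq_bigr => l _.
by rewrite scale_malgU mcoeffZ mulrCA.
Qed.

(** Adjointness of the product and Delta: both sides are linear in y1 and y2, so
    this is the case of basis elements, [matrix_sum_cat]. *)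
Lemma hform_mulr w y1 y2 :
  hform q << w >> (y1 * y2) =
    evaluate (fun ab => hform q << ab.1 >> y1 * hform q << ab.2 >> y2)
      (Delta_word q w).
Proof.
have U u v : hform q << w >> (<< u >> * << v >>) =
    evaluate (fun ab => hform q << ab.1 >> << u >> * hform q << ab.2 >> << v >>)
      (Delta_word q w).
  rewrite [<< u >> * _]fgmulUU mulr1 hformU partsM matrix_sum_cat.
  by apply: eq_evaluate => -[a b]; rewrite !hformU.
have lin_ev (f : word * word -> NLam F -> F) t :
    (forall ab, linear (f ab : NLam F -> F^o)) ->
    linear (fun y => evaluate (fun ab => f ab y) t : F^o).
  move=> lin_f c x y.
  rewrite [LHS](_ : _ = evaluate (fun ab => c * f ab x + f ab y) t).
    exact: (lin_ext_fun_linear (V := F^o)).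
  by apply: eq_evaluate => ab; rewrite lin_f.
have V u : hform q << w >> (<< u >> * y2) =
    evaluate (fun ab => hform q << ab.1 >> << u >> * hform q << ab.2 >> y2)
      (Delta_word q w).
  apply: (@eq_on_basis F _ F^o (hform q << w >> \o *%R << u >>)
    (fun y => evaluate
      (fun ab => hform q << ab.1 >> << u >> * hform q << ab.2 >> y)
      (Delta_word q w))) => [||v]; last exact: U.
    exact: linear_comp (hform_linearr _) (mul_linearr _).
  apply: lin_ev => // ab c x y; rewrite hform_linearr mulrDr; congr (_ + _).
  exact: mulrCA.
apply: (@eq_on_basis F _ F^o (hform q << w >> \o (fun y => y * y2))
  (fun y => evaluate (fun ab => hform q << ab.1 >> y * hform q << ab.2 >> y2)
    (Delta_word q w))) => [||v]; last exact: V.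
  exact: linear_comp (hform_linearr _) (mul_linearl _).
apply: lin_ev => // ab c x y; rewrite hform_linearr mulrDl; congr (_ + _).
exact/esym/mulrA.
Qed.

Lemma hform_h u m : hform q << u >> (h m%:Z) = (wdeg u == m)%:R.
Proof.
rewrite hE hformU; case: m => [|m]; first by rewrite parts1 matrix_sum_nil.
by rewrite /= {2}/parts fmuE matrix_sum1.
Qed.

(** * Pairing with the elements e_k *)

(** The indicator of the word of h_1^k, whose letters are all 0. *)
Definition is_ones k (u : word) : F := ((u : seq nat) == nseq k 0%N)%:R.

(** Against h_1^k in the first factor, the splitting h_j (x) h_(n+1-j) of a part
    n + 1 contributes only for j = 0 and j = 1, and the degree of the rest of the
    first factor is then k or k - 1. *)
Lemma evaluate_is_ones k (psi : word -> F) n t :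
  evaluate (fun ab => is_ones k ab.1 * psi ab.2) (tmul q (Delta_h F n.+1) t) =
    q ^+ (n.+1 * k) *
      evaluate (fun ab => is_ones k ab.1 * psi (mmul (hword n.+1) ab.2)) t +
    (if k is k'.+1 then q ^+ (n * k') *
      evaluate (fun ab => is_ones k' ab.1 * psi (mmul (hword n) ab.2)) t else 0).
Proof.
have ones_exp l j u :
    q ^+ (l * wdeg u) * is_ones j u = q ^+ (l * j) * is_ones j u.
  by rewrite /is_ones; case: eqP => [/wdeg_nseq->|]; rewrite ?mulr0.
rewrite evaluate_Delta_h big_ord_recl big_ord_recl /= big1 ?addr0 => [|j _].
  congr (_ + _).
    rewrite -evaluateZ; apply: eq_evaluate => -[u v] /=.
    by rewrite mul1m subn0 mulrA ones_exp mulrA.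
  have ones0 u :
      is_ones k (mmul (fmu 0) u) = if k is k'.+1 then is_ones k' u else 0.
    by rewrite /is_ones fmM fmuE; case: k.
  rewrite /bump /= subn1; case: k ones0 => [|k] ones0.
    rewrite -[RHS](evaluate0 t); apply: eq_evaluate => -[u v] /=.
    by rewrite ones0 mul0r mulr0.
  rewrite -evaluateZ; apply: eq_evaluate => -[u v] /=.
  by rewrite ones0 mulrA ones_exp mulrA.
rewrite -[RHS](evaluate0 t); apply: eq_evaluate => -[u v] /=.
rewrite (_ : is_ones k _ = 0) ?mul0r ?mulr0 // /is_ones fmM fmuE.
by case: k.
Qed.

(** The counit axiom: the only term of Delta of a word whose second factor has
    degree 0 is the word itself. *)
Lemma counit_Delta (psi : word -> F) w :
  evaluate (fun ab => psi ab.1 * (wdeg ab.2 == 0%N)%:R) (Delta_word q w) = psi w.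
Proof.
elim/word_ind: w psi => [|i w IH] psi.
  by rewrite Delta_word1 evaluateU /= /wdeg parts1 mulr1.
rewrite Delta_word_consM evaluate_Delta_h big_ord_recr /= subnn.
rewrite big1 ?add0r => [|j _].
  rewrite -(IH (fun u => psi (mmul (fmu i) u))).
  apply: eq_evaluate => -[u v] /=.
  by rewrite mul0n mul1r mul1m.
rewrite -[RHS](evaluate0 (Delta_word q w)); apply: eq_evaluate => -[u v].
rewrite wdeg_hwordM /= (_ : (_ == 0%N) = false) ?mulr0 //.
by have := ltn_ord j; lia.
Qed.

(** The recursion that defines e_k, with (., e_i) replaced by the indicator of
    h_1^i.  When the first part n + 1 of the word is split, the term of index i
    gives D_i for j = 0 and, since 'C(i, 2) = 'C(i - 1, 2) + (i - 1), gives
    - D_(i-1) for j = 1.  The sum telescopes to D_k, which vanishes because the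
    second factor would need a negative degree. *)
Lemma ones_alternating k w : (0 < k)%N ->
  \sum_(i < k.+1) (-1) ^+ i * q ^+ 'C(i, 2) *
    evaluate (fun ab => is_ones i ab.1 * (i + wdeg ab.2 == k)%N%:R)
      (Delta_word q w) = 0.
Proof.
move=> k_gt0; elim/word_ind: w => [|n w _].
  rewrite big1 // => i _; rewrite Delta_word1 evaluateU /=.
  rewrite /is_ones /wdeg parts1 fm1.
  case: i => -[|i] lt_i; rewrite /= ?addn0 ?mul0r ?mulr0 //.
  by rewrite eq_sym (gtn_eqF k_gt0) !mulr0.
pose X i := evaluate
  (fun ab => is_ones i ab.1 * (i + n.+1 + wdeg ab.2 == k)%N%:R) (Delta_word q w).
pose D i : F := (-1) ^+ i * q ^+ 'C(i, 2) * (q ^+ (n.+1 * i) * X i).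
have E i : (-1) ^+ i * q ^+ 'C(i, 2) *
    evaluate (fun ab => is_ones i ab.1 * (i + wdeg ab.2 == k)%N%:R)
      (Delta_word q (mmul (fmu n) w)) = D i - (if i is i'.+1 then D i' else 0).
  rewrite Delta_word_consM.
  rewrite (evaluate_is_ones i (fun v => (i + wdeg v == k)%N%:R)) mulrDr.
  congr (_ + _).
    rewrite /D; congr (_ * (_ * _)); apply: eq_evaluate => -[u v] /=.
    by rewrite (wdeg_hwordM n.+1) addnA.
  case: i => [|i]; first by rewrite mulr0 oppr0.
  rewrite /D -mulNr !mulrA; congr (_ * _).
    by rewrite exprS mulN1r binS bin1 exprD mulSn exprD; ring.
  apply: eq_evaluate => -[u v] /=.
  by rewrite wdeg_hwordM addnA addnS addSn.
rewrite (eq_bigr _ (fun (i : 'I_k.+1) _ => E i)) sumrB big_ord_recr /=.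
rewrite [X in _ - X]big_ord_recl /= add0r.
rewrite addrAC subrr add0r /D /X [evaluate _ _](_ : _ = 0) ?mulr0 //.
rewrite -[RHS](evaluate0 (Delta_word q w)); apply: eq_evaluate => ab.
by rewrite (_ : (_ == k) = false) ?mulr0 //; lia.
Qed.

(** By induction, all the terms of the recursion for e_k except the last are
    those of [ones_alternating]; the last ones agree too, as q is invertible. *)
Lemma hform_e (q0 : q != 0) k w : hform q << w >> (e q k%:Z) = is_ones k w.
Proof.
elim/ltn_ind: k w => -[|k] IH w.
  rewrite e0 (NLam1E F) hformU parts1 matrix_sum_nil.
  by rewrite -[sumn _]/(wdeg w) wdeg_eq0.
have rel := e_rel q0 (ltn0Sn k).
have := congr1 (hform q << w >>) rel.
rewrite hform0r hform_sumZr big_ord_recr /= subrr mulr1.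
have := ones_alternating w (ltn0Sn k); rewrite big_ord_recr /=.
rewrite (eq_evaluate
  (psi2 := fun ab => is_ones k.+1 ab.1 * (wdeg ab.2 == 0%N)%:R)); last first.
  by move=> ab /=; congr (_ * _%:R); lia.
rewrite counit_Delta => alternating rel_w.
have c_neq0 : (-1) ^+ k.+1 * q ^+ 'C(k.+1, 2) != 0.
  by rewrite mulf_neq0 ?expf_neq0 ?oppr_eq0 ?oner_eq0.
apply: (mulfI c_neq0); apply: addrI (etrans _ (esym alternating)).
apply: etrans _ rel_w; congr (_ + _); apply: eq_bigr => i _.
rewrite hform_mulr; congr (_ * _).
apply: eq_evaluate => ab; rewrite IH // subzn 1?ltnW // hform_h.
by congr (_ * _%:R); have := ltn_ord i; lia.
Qed.


End Pairing.

(** * The insertion formula *)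

Theorem lemma6p5 (R : realType) (q : R[i]) (hq : q != 0)
    (n k : int) (hn : 1 <= n) (hk : 0 <= k)
    (lam : seq nat) (hlam : is_composition lam) (x : NLam R[i]) :
  hform q (h n * hcomp lam) (e q k * x) =
    q ^ ((k - 1) * (n - 1)) * insertion q lam (k - 1) x (h (n - 1)) +
    q ^ (k * n) * insertion q lam k x (h n).
Proof.
case: n hn => [[|n]|] // _; case: k hk => [k|] // _.
have [w ->] : exists w : word, lam = parts w.
  exists (FMonom [seq i.-1 | i <- lam]).
  rewrite /parts /= -map_comp map_id_in // => i.
  by move/(allP hlam)/prednK.
have insE (j m : nat) : insertion q (parts w) j%:Z x << hword m >> =
    evaluate
      (fun ab => is_ones _ j ab.1 * hform q << mmul (hword m) ab.2 >> x)
      (Delta_word q w).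
  rewrite /insertion hcomp_word /Delta lin_extU; apply: eq_evaluate => ab.
  by rewrite hform_e // [_ * << ab.2 >>]fgmulUU mulr1.
rewrite hcomp_word hE [_ * << w >>]fgmulUU mulr1 hform_mulr Delta_word_consM.
rewrite (eq_evaluate
  (psi2 := fun ab => is_ones _ k ab.1 * hform q << ab.2 >> x)); last first.
  by move=> ab; rewrite hform_e.
rewrite (evaluate_is_ones q k (fun v => hform q << v >> x)) addrC insE.
rewrite [n.+1%:Z - 1](_ : _ = n%:Z); last by rewrite subzn // subn1.
rewrite hE.
congr (_ + _); last by rewrite mulnC.
case: k => [|k].
  (* The first term is zero because e_(-1) = 0. *)
  rewrite /insertion [X in _ * X](_ : _ = 0) ?mulr0 //.
  rewrite -[RHS](evaluate0 (Delta q (hcomp (parts w)))).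
  apply: eq_evaluate => ab.
  by rewrite hform0r mul0r.
by rewrite subzn // subn1 /= insE mulnC.
Qed.
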